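(* Let $Z(1-e^{z_1}-e^{z_2})=\{(z_1,z_2)\in\mathbb{C}^2 : 1-e^{z_1}-e^{z_2}=0\}$ and let $R:=\{(\mathrm{Re}(z_1),\mathrm{Re}(z_2)) : (z_1,z_2)\in Z(1-e^{z_1}-e^{z_2})\}\subset\mathbb{R}^2$. The problem of determining, for arbitrary input $r_1,r_2\in\mathbb{R}$, whether $(r_1,r_2)\in R$ is undecidable in the BSS model over $\mathbb{R}$; that is, there is no BSS machine over $\mathbb{R}$ that halts on every input $(r_1,r_2)\in\mathbb{R}^2$ and correctly outputs whether $(r_1,r_2)\in R$.
   Context: The BSS (Blum-Shub-Smale) model over $\mathbb{R}$ augments the classical Turing machine by allowing exact field operations and comparisons over $\mathbb{R}$, each in unit time; inputs are finite sequences of real numbers, and a machine is a fixed finite program (which may use finitely many fixed real constants). A set is decidable if there is a BSS machine that halts on every input and correctly decides membership in the set. *)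

(* Defs.v *)
From HB Require Import structures.
From mathcomp Require Import all_boot all_order all_algebra.
From mathcomp Require Import all_classical all_reals all_analysis.
From mathcomp Require Import complex ring.

Set Implicit Arguments.
Unset Strict Implicit.
Unset Printing Implicit Defensive.

Import Order.TTheory GRing.Theory Num.Theory.

Local Open Scope classical_set_scope.
Local Open Scope ring_scope.

(* The machines follow Blum, Cucker, Shub and Smale: the memory is a two-way
   infinite tape of reals and the program is a finite flowchart (here, a finite
   list of instructions with jumps).  A polynomial or rational computation node
   is split into single field operations, each of which takes one step.        *)

Inductive bss_instr (R : Type) : Type :=
| BConst of int & R                 (* x_i := c         *)
| BAdd of int & int & int           (* x_i := x_j + x_k *)
| BSub of int & int & int           (* x_i := x_j - x_k *)
| BMul of int & int & int           (* x_i := x_j * x_k *)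
| BDiv of int & int & int           (* x_i := x_j / x_k *)
| BShiftl
| BShiftr
| BJumpLe of int & int & nat        (* if x_i <= x_j then goto the given line *)
| BHalt.

Arguments BConst {R}.
Arguments BAdd {R}.
Arguments BSub {R}.
Arguments BMul {R}.
Arguments BDiv {R}.
Arguments BShiftl {R}.
Arguments BShiftr {R}.
Arguments BJumpLe {R}.
Arguments BHalt {R}.

(* The real constants of a machine are those occurring in its BConst lines. *)
Definition bss_machine (R : Type) : Type := seq (bss_instr R).

Section BSS.
Variable R : realType.
Implicit Types (M : bss_machine R) (x : seq R).

Definition tape : Type := int -> R.

Definition set_cell (s : tape) (i : int) (a : R) : tape :=
  fun j => if j == i then a else s j.

Definition config : Type := (nat * tape)%type.

(* None means that the computation is stuck: on a halting instruction, on a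
   line number outside the program, or on a division by zero.  Only the first
   case counts as halting. *)
Definition bss_step M (c : config) : option config :=
  let: (l, s) := c in
  match nth BHalt M l with
  | BConst i a => Some (l.+1, set_cell s i a)
  | BAdd i j k => Some (l.+1, set_cell s i (s j + s k))
  | BSub i j k => Some (l.+1, set_cell s i (s j - s k))
  | BMul i j k => Some (l.+1, set_cell s i (s j * s k))
  | BDiv i j k =>
      if s k == 0 then None else Some (l.+1, set_cell s i (s j / s k))
  | BShiftl => Some (l.+1, fun i => s (i + 1))
  | BShiftr => Some (l.+1, fun i => s (i - 1))
  | BJumpLe i j l' => Some (if s i <= s j then l' else l.+1, s)
  | BHalt => None
  end.

Definition bss_halted M (c : config) : Prop :=
  (c.1 < size M)%N /\ nth BHalt M c.1 = BHalt.

(* The input x_0, ..., x_(n-1) is written in cells 0, ..., n-1, and its length n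
   is written in unary in cells -1, ..., -n; Negz k is the integer -(k+1). *)
Definition bss_input x : tape :=
  fun i => match i with
           | Posz k => x`_k
           | Negz k => if (k < size x)%N then 1 else 0
           end.

Definition bss_run M x (t : nat) : option config :=
  iter t (obind (bss_step M)) (Some (0%N, bss_input x)).

(* M halts on input x with a in the output cell x_0. *)
Definition bss_outputs M x (a : R) : Prop :=
  exists t c, [/\ bss_run M x t = Some c, bss_halted M c & c.2 0 = a].

(* Decidability of a set S of instances, an instance p being presented to the
   machine as the sequence enc p: the characteristic function of S is computed
   by a machine which halts on all instances. *)
Definition bss_decidable (I : Type) (enc : I -> seq R) (S : set I) : Prop :=
  exists M, forall p : I, bss_outputs M (enc p) (\1_S p).

End BSS.

Section RealParts.
Variable R : realType.

(* Euler's formula: e^(a + ib) = e^a (cos b + i sin b). *)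
Definition cexp (z : R[i]) : R[i] :=
  Complex (expR (complex.Re z) * cos (complex.Im z))
          (expR (complex.Re z) * sin (complex.Im z)).

Lemma cexpD (z w : R[i]) : cexp (z + w) = cexp z * cexp w.
Proof.
case: z w => [a b] [c d]; rewrite /cexp /= expRD cosD sinD.
by apply/eqP; rewrite eq_complex /=; apply/andP; split; apply/eqP; ring.
Qed.

Lemma cexp_real (x : R) : cexp (Complex x 0) = Complex (expR x) 0.
Proof. by rewrite /cexp /= cos0 sin0 mulr1 mulr0. Qed.

Definition zero_set (f : R[i] * R[i] -> R[i]) : set (R[i] * R[i]) :=
  [set z | f z = 0].

Definition real_parts (Z : set (R[i] * R[i])) : set (R * R) :=
  [set (complex.Re z.1, complex.Re z.2) | z in Z].

End RealParts.

(* Main.v *)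
Require Import Defs.
From mathcomp Require Import all_boot all_order all_algebra.
From mathcomp Require Import all_classical all_reals all_analysis.
From mathcomp Require Import complex.
From mathcomp Require Import ring lra zify polyrcf.

(** The set of the theorem is cut out by the triangle inequalities between
    1, e^r1 and e^r2, so the curve t |-> (ln t, ln (1 + t)), t > 0, where
    e^r2 = 1 + e^r1, consists of points of the set that are limits of points
    outside it ([boundary_mem], [real_parts_le]).

    Suppose that a machine decides the set.  Let K be a countable ring of
    polynomials in (r1, r2) which contains both coordinates and the constants
    of the machine ([countable_subring]).  There is a point p0 of the curve at
    which no nonzero element of K vanishes ([exists_generic]).  During the
    computation on p0 every cell contains a fraction of elements of K.  A test
    compares two such fractions: either they are equal at p0, and then they are
    formally equal, or they differ at p0, and then by continuity the outcome is
    the same at all nearby points.  Hence all points near p0 follow the same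
    computation path, and the output is near p0 a single rational function,
    continuous at p0 ([near_bss_run]).  As it is 1 at p0, the set would
    contain a neighbourhood of p0, which is absurd.

    The existence of p0 is a counting argument: it is enough that, for every
    nonzero polynomial P, the function P(ln t, ln (1 + t)) has countably many
    zeros.  Two facts give this.
    - Such a function has finitely many zeros or vanishes for all t > 0
      ([logsum_few_zeros]).  By Rolle's theorem this dichotomy passes from a
      derivative to the function; multiplying by a positive function does not
      affect it either.  Consider sums of terms
      p(t) w^-a ln(t)^i ln(1 + t)^j with w = t (1 + t).  Differentiation lowers
      the degree of the polynomials p in front of the terms for which i + j is
      maximal, at the price of denominators in the other terms only; after
      finitely many derivations the maximum of i + j has dropped, a power of w
      clears the denominators, and the process starts again, until the zero
      function is reached.
    - It vanishes for all t > 0 only if P = 0 ([ln_ln1D_independent]): as t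
      tends to 0, ln (1 + t) decays like t, faster than any power of ln t
      grows, which forces the coefficients of P, seen as a polynomial in its
      second variable, to vanish one after the other. *)

Set Implicit Arguments.
Unset Strict Implicit.
Unset Printing Implicit Defensive.

Import Order.TTheory GRing.Theory Num.Theory.
Import numFieldNormedType.Exports.

Local Open Scope classical_set_scope.
Local Open Scope ring_scope.

(** * Zeros of polynomials in t, ln t and ln (1 + t) *)

Section Zeros.
Variable R : realType.
Implicit Types (f g : R -> R) (t x : R).

(** Finiteness is expressed by bounding the length of increasing lists of
    zeros, the form in which Rolle's theorem applies by induction on the list. *)
Definition few_zeros f : Prop :=
  (exists N, forall s, path <%R 0 s -> all (fun t => f t == 0) s ->
     (size s <= N)%N) \/ (forall t, 0 < t -> f t = 0).

Lemma path_pos x (s : seq R) : path <%R x s -> 0 <= x -> all (fun t => 0 < t) s.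
Proof.
elim: s x => //= y s IHs x /andP[xy ys] x0.
by rewrite (le_lt_trans x0 xy) (IHs y) // ltW // (le_lt_trans x0 xy).
Qed.

(** Between two consecutive zeros of f there is a zero of f'.  That the new
    list starts beyond x is what the induction needs to glue the next zero. *)
Lemma rolle_path f g :
  (forall t, 0 < t -> is_derive t 1 f (g t)) ->
  forall s x, 0 < x -> f x = 0 -> path <%R x s -> all (fun t => f t == 0) s ->
  exists s', [/\ path <%R x s', size s' = size s & all (fun t => g t == 0) s'].
Proof.
move=> fg; elim=> [|y s IHs] x x0 fx /=; first by exists [::].
move=> /andP[xy ys] /andP[/eqP fy fs].
have y0 : 0 < y by apply: lt_trans xy.
have [s' [ps' <- gs']] := IHs y y0 fy ys fs.
have [|||c /itvP cxy gc] := @Rolle R f x y xy.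
- move=> z /itvP zxy.
  by have /fg[] : 0 < z by apply: lt_trans x0 _; rewrite zxy.
- apply: derivable_within_continuous => z /itvP zxy.
  by have /fg[] : 0 < z by apply: lt_le_trans x0 _; rewrite zxy.
- by rewrite fx fy.
exists (c :: s'); split => //=.
  rewrite cxy /=; case: s' ps' {gs'} => //= z s' /andP[yz ->].
  by rewrite (lt_trans _ yz) ?cxy.
rewrite gs' andbT.
have c0 : 0 < c by apply: lt_trans x0 _; rewrite cxy.
by have [_ <-] := fg _ c0; case: gc => _ ->.
Qed.

(** The derivative loses at most one zero; and if it vanishes everywhere, the
    function is constant. *)
Lemma few_zeros_derive f g :
  (forall t, 0 < t -> is_derive t 1 f (g t)) -> few_zeros g -> few_zeros f.
Proof.
move=> fg [[N gN]|g0].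
  left; exists N.+1 => -[|x s] //= /andP[x0 xs] /andP[/eqP fx fs].
  have [s' [ps' <- gs']] := rolle_path fg x0 fx xs fs.
  rewrite ltnS gN //.
  by case: s' ps' {gs'} => //= y s' /andP[xy ->]; rewrite (lt_trans x0 xy).
have fcst a b : 0 < a -> a <= b -> f a = f b.
  move=> a0 ab; have [||c /itvP cab] := @MVT_segment R f g a b ab.
  - by move=> z /itvP zab; apply: fg; apply: lt_trans a0 _; rewrite zab.
  - apply: derivable_within_continuous => z /itvP zab.
    by have /fg[] : 0 < z by apply: lt_le_trans a0 _; rewrite zab.
  rewrite g0 ?mul0r; first by move/eqP; rewrite subr_eq0 => /eqP.
  by apply: lt_le_trans a0 _; rewrite cab.
have fcst1 t : 0 < t -> f t = f 1.
  by move=> t0; have [/fcst->|/ltW/fcst->] := leP t 1.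
have [f10|f10] := eqVneq (f 1) 0.
  by right=> t t0; rewrite fcst1.
left; exists 0%N => -[//|x s] /= /andP[x0 _] /andP[/eqP fx _].
by rewrite -(fcst1 x) ?fx ?eqxx in f10.
Qed.

Lemma few_zeros_mul f g :
  (forall t, 0 < t -> g t != 0) -> few_zeros (fun t => g t * f t) -> few_zeros f.
Proof.
move=> gN [[N fN]|f0]; [left|right].
  exists N => s s0 /allP sf; apply: fN => //.
  by apply/allP => x /sf /eqP ->; rewrite mulr0.
move=> t t0; have /eqP := f0 t t0.
by rewrite mulf_eq0 (negPf (gN _ t0)) => /eqP.
Qed.

Lemma eq_few_zeros f g :
  (forall t, 0 < t -> f t = g t) -> few_zeros f -> few_zeros g.
Proof.
move=> fg [[N fN]|f0]; [left|right] => [|t t0]; last by rewrite -fg ?f0.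
exists N => s s0 /allP sg; apply: fN => //; apply/allP => x xs.
by rewrite fg ?sg //; exact: (allP (path_pos s0 (lexx _))).
Qed.

Lemma few_zeros_countable f : few_zeros f -> (exists2 t, 0 < t & f t != 0) ->
  countable [set t | 0 < t /\ f t = 0].
Proof.
move=> [[N fN] _|f0 [t /f0 ->]]; last by rewrite eqxx.
apply: finite_set_countable; apply: contrapT => /(@infinite_set_fset _ _ N.+1).
case=> B sB sizeB.
have inB t : t \in sort <=%R (finmap.enum_fset B) -> 0 < t /\ f t = 0.
  by rewrite mem_sort => tB; apply: sB.
have : (size (sort <=%R (finmap.enum_fset B)) <= N)%N.
  apply: fN; last by apply/allP => t /inB[_ ->].
  have : sorted <%R (sort <=%R (finmap.enum_fset B)).
    by rewrite sort_lt_sorted finmap.fset_uniq.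
  case: (sort _ _) inB => //= t s inB ->.
  by have [-> _] := inB t (mem_head _ _).
by rewrite size_sort leqNgt sizeB.
Qed.

(** The tuple (p, a, i, j) stands for p(t) w(t)^-a ln(t)^i ln(1 + t)^j, where
    w(t) = t (1 + t) is the common denominator of the derivatives of the two
    logarithms. *)
Definition logterm : Type := ({poly R} * nat * nat * nat)%type.

Definition den_poly : {poly R} := 'X * (1 + 'X).

Definition logterm_eval (m : logterm) t : R :=
  let: (p, a, i, j) := m in
  p.[t] * den_poly.[t] ^- a * ln t ^+ i * ln (1 + t) ^+ j.

Definition logsum (s : seq logterm) t : R := \sum_(m <- s) logterm_eval m t.

Definition logterm_deriv (m : logterm) : seq logterm :=
  let: (p, a, i, j) := m in
  [:: (p^`(), a, i, j); (- (a%:R *: (p * den_poly^`())), a.+1, i, j);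
      (i%:R *: (p * (1 + 'X)), a.+1, i.-1, j);
      (j%:R *: (p * 'X), a.+1, i, j.-1)].

(** The class that drives the induction: terms of logarithmic degree i + j
    less than d, and terms of degree exactly d whose coefficient is a polynomial
    (no denominator) of size at most n.  Zero coefficients are accepted, so that
    the vanishing terms of a derivative need no special treatment. *)
Definition admissible d n (m : logterm) : bool :=
  let: (p, a, i, j) := m in
  [|| p == 0, (i + j < d)%N | [&& (i + j == d)%N, a == 0%N & (size p <= n)%N]].

Lemma den_poly_gt0 t : 0 < t -> 0 < den_poly.[t].
Proof. by move=> t0; rewrite !hornerE mulr_gt0 // addr_gt0. Qed.

Lemma is_derive_pow f df n t : is_derive t 1 f df ->
  is_derive t 1 (fun x => f x ^+ n) (n%:R * f t ^+ n.-1 * df).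
Proof.
move=> h; have := @is_deriveX _ _ f n t 1 _ h.
by rewrite exprfctE.
Qed.

Lemma is_derive_ln1 t : 0 < t -> is_derive t 1 (fun t => ln (1 + t)) (1 + t)^-1.
Proof.
move=> t0; have t1 : 0 < 1 + t by rewrite addr_gt0.
have h1 : is_derive t 1 (fun t : R => 1 + t) 1.
  have -> : (fun t : R => 1 + t) = horner (1 + 'X).
    by apply/funext => z; rewrite !hornerE.
  apply: (is_derive_eq (is_derive_poly _ t)).
  by rewrite derivD derivC derivX add0r hornerC.
have := @is_derive1_comp _ _ _ _ _ _ (is_derive1_ln t1) h1.
by rewrite mulr1.
Qed.

Lemma is_derive_logterm m t : 0 < t ->
  is_derive t 1 (logterm_eval m) (logsum (logterm_deriv m) t).
Proof.
case: m => [[[p a] i] j] t0 /=.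
have w0 := den_poly_gt0 t0.
have wn0 : den_poly.[t] ^+ a != 0 by rewrite expf_neq0 // gt_eqF.
have hw := is_derive_pow a (is_derive_poly den_poly t).
have hwV := @is_deriveV _ _ t _ 1 wn0 hw.
have h1 := @is_deriveM _ _ _ _ t 1 _ _ (is_derive_poly p t) hwV.
have h2 := @is_deriveM _ _ _ _ t 1 _ _ h1 (is_derive_pow i (is_derive1_ln t0)).
have h3 := @is_deriveM _ _ _ _ t 1 _ _ h2 (is_derive_pow j (is_derive_ln1 t0)).
apply: (is_derive_eq h3).
rewrite /logsum !big_cons big_nil /=.
have wE : den_poly.[t] = t * (1 + t) by rewrite !hornerE.
move: (den_poly) w0 wn0 wE {hw hwV h1 h2 h3} => w w0 wn0 wE.
rewrite ![in RHS](hornerN, hornerZ, hornerM, hornerX, hornerD, hornerC) !(exprS w.[t] a).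
have -> : a%:R * w.[t] ^+ a.-1 = a%:R * w.[t] ^+ a / w.[t].
  case: (a) => [|b]; first by rewrite !mul0r.
  by rewrite /= exprS; field; rewrite gt_eqF.
rewrite !fctE /GRing.scale /=.
set W := w.[t] ^+ a in wn0 *; set L := ln t ^+ i; set L' := ln t ^+ _.
set K := ln _ ^+ j; set K' := ln _ ^+ _.
set w' := (w^`()).[t].
rewrite wE.
have t1 : 1 + t != 0 by rewrite gt_eqF // addr_gt0.
have tn0 : t != 0 by rewrite gt_eqF.
by field; rewrite t1 wn0.
Qed.

Lemma is_derive_logsum s t : 0 < t ->
  is_derive t 1 (logsum s) (logsum (flatten (map logterm_deriv s)) t).
Proof.
move=> t0; elim: s => [|m s IHs] /=.
  rewrite /logsum big_nil.
  have -> : (fun t => \sum_(m <- [::]) logterm_eval m t) = cst 0.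
    by apply/funext => z; rewrite big_nil.
  exact: is_derive_cst.
have -> : logsum (m :: s) = logterm_eval m + logsum s.
  by apply/funext => z; rewrite /logsum big_cons.
rewrite /logsum big_cat; exact: is_deriveD (is_derive_logterm m t0) IHs.
Qed.

(** Differentiating a logarithm lowers i + j, whereas differentiating the
    coefficient of a term of top degree lowers its size; only terms below the
    top degree can acquire a denominator. *)
Lemma admissible_deriv d n m :
  admissible d n.+1 m -> all (admissible d n) (logterm_deriv m).
Proof.
case: m => [[[p a] i] j] /= H; rewrite andbT.
case/or3P: H => [/eqP->|ij|/and3P[/eqP ij /eqP -> sp]].
- by rewrite deriv0 !mul0r !scaler0 oppr0 eqxx.
- by rewrite ij !orbT /=; apply/andP; split; apply/or3P; apply: Or32; lia.
- rewrite scale0r oppr0 ij !eqxx /=.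
  apply/and3P; split; apply/or3P.
  + apply: Or33; have [->|p0] := eqVneq p 0; first by rewrite deriv0 size_poly0.
    by rewrite -ltnS (leq_trans (lt_size_deriv p0)).
  + by case: i ij => [|i] ij; [apply: Or31; rewrite scale0r|apply: Or32 => /=; lia].
  + by case: j ij => [|j] ij; [apply: Or31; rewrite scale0r|apply: Or32 => /=; lia].
Qed.

Lemma admissible_deg0 s t : all (admissible 0 0) s -> logsum s t = 0.
Proof.
move=> /allP sadm; rewrite /logsum big1_seq // => -[[[p a] i] j] /andP[_ /sadm].
rewrite /= size_poly_leq0 => /orP[/eqP->|/and3P[_ _ /eqP->]];
  by rewrite horner0 !mul0r.
Qed.

(** Once the terms of top degree have disappeared, a power of w turns the
    remaining sum into one of lower degree with polynomial coefficients. *)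
Lemma clear_denominators d s : all (admissible d.+1 0) s ->
  exists N n s', all (admissible d n) s' /\
    forall t, 0 < t -> den_poly.[t] ^+ N * logsum s t = logsum s' t.
Proof.
move=> /allP sadm.
pose N := \max_(m <- s) m.1.1.2.
pose c (m : logterm) : logterm :=
  let: (p, a, i, j) := m in (p * den_poly ^+ (N - a), 0%N, i, j).
pose n := \max_(m <- s) size (c m).1.1.1.
exists N, n, (map c s); split.
  apply/allP => _ /mapP[m ms ->].
  have : (size (c m).1.1.1 <= n)%N.
    exact: (leq_bigmax_seq (F := fun m => size (c m).1.1.1)).
  case: m ms => [[[p a] i] j] /sadm /= /or3P[/eqP->|ij|/and3P[_ _]] sz.
  - by rewrite mul0r eqxx.
  - by rewrite sz andbT; apply/or3P; move: ij; rewrite ltnS leq_eqVlt;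
      case/orP => ->; [apply: Or33|apply: Or32].
  - by move: sz; rewrite size_poly_leq0 => /eqP ->; rewrite mul0r eqxx.
move=> t t0; rewrite /logsum big_map mulr_sumr; apply: eq_big_seq => m ms.
have : (m.1.1.2 <= N)%N.
  exact: (leq_bigmax_seq (F := fun m : logterm => m.1.1.2)).
case: m {ms} => [[[p a] i] j] /= aN.
have w0 : den_poly.[t] ^+ a != 0 by rewrite expf_neq0 // gt_eqF // den_poly_gt0.
rewrite !mulrA [(p * _).[t]]hornerM horner_exp expr0 invr1 mulr1 -{1}(subnK aN) exprD.
by congr (_ * _ * _); field.
Qed.

(** Lexicographic induction on the logarithmic degree d and on the size n of
    the coefficients in degree d. *)
Lemma logsum_few_zeros s : few_zeros (logsum s).
Proof.
have [d sd] : exists d, all (admissible d 0) s.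
  exists (\max_(m <- s) (m.1.2 + m.2)).+1; apply/allP => m ms.
  have : (m.1.2 + m.2 <= \max_(m <- s) (m.1.2 + m.2))%N.
    exact: (leq_bigmax_seq (F := fun m : logterm => (m.1.2 + m.2)%N)).
  by case: m {ms} => [[[p a] i] j] /= ij; rewrite ltnS ij orbT.
elim: d s sd => [|d IHd] s sd; first by right=> t _; exact: admissible_deg0.
have [N [n [s' [s'adm sE]]]] := clear_denominators sd.
apply: (@few_zeros_mul _ (fun t => den_poly.[t] ^+ N)) => [t t0|].
  by rewrite expf_neq0 // gt_eqF // den_poly_gt0.
apply: (@eq_few_zeros (logsum s')) => [t /sE ->//|].
elim: n s' s'adm {sE sd} => [|n IHn] s' s'adm; first exact: IHd.
apply: (few_zeros_derive (is_derive_logsum s')).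
apply: IHn; apply/allP => m' /flatten_mapP[m /(allP s'adm)].
by move=> /admissible_deriv/allP; exact.
Qed.
End Zeros.

(** * Generic points of the curve (ln t, ln (1 + t)) *)

Section Independence.
Variable R : realType.
Implicit Types (P Q : {poly {poly R}}) (t x y : R).

(** With x as the inner indeterminate, induction on P splits off powers of y. *)
Definition bieval P x y : R := P.[y%:P].[x].

Lemma bieval_MXaddC P (c : {poly R}) x y :
  bieval (P * 'X + c%:P) x y = bieval P x y * y + c.[x].
Proof. by rewrite /bieval !hornerE. Qed.

(** Put s = - ln t: this is s^k / k! <= e^s. *)
Lemma lnX_mul_bounded k t : 0 < t <= 1 -> `|ln t ^+ k| * t <= k`!%:R.
Proof.
move=> /andP[t0 t1]; case: k => [|k]; first by rewrite normr1 mul1r.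
have s0 : 0 <= - ln t by rewrite oppr_ge0 ln_le0.
have := expR_ge1Dxn k s0; rewrite expRN lnK ?posrE// => h.
have -> : `|ln t ^+ k.+1| = (- ln t) ^+ k.+1 by rewrite normrX -normrN ger0_norm.
rewrite -ler_pdivlMr // -ler_pdivrMl ?ltr0n ?fact_gt0 // mulrC.
by apply: le_trans h; rewrite lerDr.
Qed.

Lemma horner_ln_mul_bounded (q : {poly R}) :
  exists C, forall t, 0 < t <= 1 -> `|q.[ln t]| * t <= C.
Proof.
exists (\sum_(i < size q) `|q`_i| * i`!%:R) => t t01.
have t0 : 0 <= t by case/andP: t01 => /ltW.
rewrite horner_coef (le_trans (ler_wpM2r t0 (ler_norm_sum _ _ _))) // mulr_suml.
apply: ler_sum => i _; rewrite normrM -mulrA ler_wpM2l //.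
exact: lnX_mul_bounded.
Qed.

Lemma ln1D_le t : 0 < t -> 0 < ln (1 + t) <= t.
Proof.
move=> t0; rewrite ln_gt0 ?ltrDl // le_ln1Dx // (lt_trans _ t0) //.
Qed.

Lemma bieval_mul_bounded P :
  exists C, forall t, 0 < t <= 1 -> `|bieval P (ln t) (ln (1 + t))| * t <= C.
Proof.
elim/poly_ind: P => [|P c [C PC]].
  by exists 0 => t _; rewrite /bieval !horner0 normr0 mul0r.
have [D cD] := horner_ln_mul_bounded c.
exists (C + D) => t t01; have /andP[t0 t1] := t01.
have /andP[y0 yt] := ln1D_le t0.
rewrite bieval_MXaddC (le_trans (ler_wpM2r (ltW t0) (ler_normD _ _))) // mulrDl.
rewrite lerD ?cD // (le_trans _ (PC t t01)) // ler_wpM2r ?(ltW t0) //.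
by rewrite normrM ler_piMr // gtr0_norm // (le_trans yt).
Qed.

(** If c were nonzero, then c * 'X would not be constant, hence would be
    unbounded on the negative axis. *)
Lemma bounded_poly_mulX_eq0 (c : {poly R}) C :
  (forall x, x <= 0 -> `|(c * 'X).[x]| <= C) -> c = 0.
Proof.
move=> cC; apply/eqP; apply: contraT => c0; exfalso.
(* The square makes the leading coefficient positive whatever the parity of
   the degree. *)
pose h := (c * 'X) \Po (- 'X).
have sX : size (- 'X : {poly R}) = 2%N by rewrite size_polyN size_polyX.
have sh : (1 < size h)%N.
  by rewrite size_comp_poly2 // size_mulX // ltnS lt0n size_poly_eq0.
have h0 : h != 0 by rewrite -size_poly_gt0 ltnW.
pose g := h ^+ 2 - (C ^+ 2)%:P.
have lcg : 0 < lead_coef g.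
  rewrite lead_coefDl; last first.
    rewrite size_polyN (leq_ltn_trans (size_polyC_leq1 _)) //.
    rewrite expr2 size_mul //; move: sh; case: (size h) => [|[|m]] // _; lia.
  by rewrite lead_coef_exp exprn_even_gt0 //= lead_coef_eq0.
have [n ng] := poly_pinfty_gt_lc lcg.
pose x := Num.max n 0.
have := lt_le_trans lcg (ng x _); rewrite le_max lexx => /(_ isT).
rewrite /g hornerD hornerN hornerC horner_exp subr_gt0 horner_comp hornerN hornerX.
apply/negP; rewrite -leNgt -real_normK ?num_real //.
have xC := cC (- x).
rewrite lerXn2r ?nnegrE //; last by rewrite xC // oppr_le0 le_max lexx orbT.
by rewrite (le_trans _ (xC _)) // oppr_le0 le_max lexx orbT.
Qed.

(** Write P = Q Y + c(X).  On the curve c(X) = - Y Q(X, Y) with 0 < Y <= t, so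
    X c(X) is bounded by t |X Q(X, Y)|, hence bounded as X = ln t tends to minus
    infinity; so c = 0.  Then Y can be cancelled, and Q takes the place of P. *)
Lemma ln_ln1D_independent P :
  (forall t, 0 < t -> bieval P (ln t) (ln (1 + t)) = 0) -> P = 0.
Proof.
elim/poly_ind: P => // P c IHP P0.
have c0 : c = 0.
  have [C PC] := bieval_mul_bounded (P * ('X : {poly R})%:P).
  apply: (@bounded_poly_mulX_eq0 _ C) => x x0.
  have t01 : 0 < expR x <= 1 by rewrite expR_gt0 -[1]expR0 ler_expR.
  have /andP[t0 _] := t01; have /andP[y0 yt] := ln1D_le t0.
  have := PC _ t01; apply: le_trans.
  have := P0 _ t0; rewrite bieval_MXaddC expRK => /eqP.
  rewrite addrC addr_eq0 hornerM hornerX => /eqP ->.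
  have -> : bieval (P * ('X)%:P) x (ln (1 + expR x)) = bieval P x (ln (1 + expR x)) * x.
    by rewrite /bieval !hornerE.
  rewrite mulNr normrN mulrAC normrM.
  by rewrite ler_wpM2l // gtr0_norm.
rewrite c0 addr0 IHP ?mul0r // => t t0.
have := P0 t t0; rewrite bieval_MXaddC c0 horner0 addr0 => /eqP.
by have /andP[y0 _] := ln1D_le t0; rewrite mulf_eq0 (gt_eqF y0) orbF => /eqP.
Qed.

Lemma bieval_logsum P : exists s, forall t,
  logsum s t = bieval P (ln t) (ln (1 + t)).
Proof.
elim/poly_ind: P => [|P c [s sP]].
  by exists [::] => t; rewrite /bieval !horner0 /logsum big_nil.
pose incr (m : logterm R) : logterm R := let: (p, a, i, j) := m in (p, a, i, j.+1).
exists (map incr s ++ [seq ((c`_i)%:P, 0%N, i, 0%N) | i <- index_iota 0 (size c)]).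
move=> t; rewrite bieval_MXaddC -sP /logsum big_cat /= !big_map; congr (_ + _).
  rewrite mulr_suml; apply: eq_bigr => -[[[p a] i] j] _ /=.
  by rewrite exprSr mulrA.
rewrite big_mkord horner_coef; apply: eq_bigr => i _ /=.
by rewrite hornerC invr1 !mulr1.
Qed.

Lemma countableU (T : Type) (A B : set T) :
  countable A -> countable B -> countable (A `|` B).
Proof.
move=> cA cB; have -> : A `|` B = \bigcup_b (if b then A else B).
  apply/seteqP; split=> [x [Ax|Bx]|x [[] _ ?]]; [by exists true|by exists false|..];
  by [left|right].
by apply: bigcup_countable => // -[].
Qed.

(** The ring is the union of the stages obtained by adding repeatedly all
    differences and products to S and 1. *)
Lemma countable_subring (A : pzRingType) (S : set A) : countable S ->
  exists K : set A, [/\ countable K, S `<=` K, K 1,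
    forall a b, K a -> K b -> K (a - b) & forall a b, K a -> K b -> K (a * b)].
Proof.
move=> cS.
pose step (L : set A) := [set ab.1 - ab.2 | ab in L `*` L] `|`
   [set ab.1 * ab.2 | ab in L `*` L] `|` L.
pose L n := iter n step (1 |` S).
have LL m n : (m <= n)%N -> L m `<=` L n.
  elim: n => [|n IHn]; first by rewrite leqn0 => /eqP ->.
  rewrite leq_eqVlt => /predU1P[->//|]; rewrite ltnS => /IHn Lmn a /Lmn.
  by right.
exists (\bigcup_n L n); split.
- apply: bigcup_countable => // n _; elim: n => [|n IHn].
    exact: countableU.
  have cX : countable (L n `*` L n) by exact: countableX.
  apply: countableU => //; apply: countableU; exact: sub_countable (card_image_le _ _) cX.
- by move=> a Sa; exists 0%N => //; right.
- by exists 0%N => //; left.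
- move=> a b [m _ La] [n _ Lb]; exists (maxn m n).+1 => //; left; left.
  by exists (a, b) => //; split; [apply: LL La|apply: LL Lb]; rewrite (leq_maxl, leq_maxr).
- move=> a b [m _ La] [n _ Lb]; exists (maxn m n).+1 => //; left; right.
  by exists (a, b) => //; split; [apply: LL La|apply: LL Lb]; rewrite (leq_maxl, leq_maxr).
Qed.

(** The bad parameters form a countable union of countable sets, which cannot
    contain ]0, 1[, an interval of positive measure. *)
Lemma exists_generic (K : set {poly {poly R}}) : countable K ->
  exists2 t, 0 < t & forall P, K P -> bieval P (ln t) (ln (1 + t)) = 0 -> P = 0.
Proof.
move=> cK; apply: contrapT => noT.
pose bad P := [set t | 0 < t /\ bieval P (ln t) (ln (1 + t)) = 0].
have : countable `]0 : R, 1[%classic.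
  apply: (@sub_countable _ _ _ (\bigcup_(P in K `&` [set P | P != 0]) bad P)).
    apply: subset_card_le => t /=; rewrite in_itv /= => /andP[t0 _].
    apply: contrapT => tgen; apply: noT; exists t => // P KP Pt.
    by apply/eqP; apply: contraT => P0; exfalso; apply: tgen; exists P.
  apply: bigcup_countable => [|P [_ /= P0]].
    by apply: sub_countable cK; apply: subset_card_le => P [].
  have [s sE] := bieval_logsum P.
  have := @few_zeros_countable _ (logsum s) (logsum_few_zeros s).
  rewrite /bad; under eq_set do rewrite sE; apply.
  apply: contrapT => s0; move/eqP: P0; apply; apply: ln_ln1D_independent => t t0.
  rewrite -sE; apply/eqP; apply: contraT => st; exfalso; apply: s0.
  by exists t.
move=> /countable_lebesgue_measure0; rewrite lebesgue_measure_itv /= lte_fin ltr01.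
by rewrite sube0 => /eqP; rewrite eqe oner_eq0.
Qed.
End Independence.

(** * The computation path near a generic point *)

Section Machine.
Variable R : realType.
Implicit Types (P Q : {poly {poly R}}) (M : bss_machine R) (p : R * R).

Definition peval P p : R := bieval P p.1 p.2.

Lemma pevalB P Q p : peval (P - Q) p = peval P p - peval Q p.
Proof. by rewrite /peval /bieval !hornerE. Qed.

Lemma pevalM P Q p : peval (P * Q) p = peval P p * peval Q p.
Proof. by rewrite /peval /bieval !hornerE. Qed.

Lemma pevalC a p : peval a%:P%:P p = a.
Proof. by rewrite /peval /bieval !hornerE. Qed.

Lemma peval_continuous P : continuous (peval P).
Proof.
move=> p; elim/poly_ind: P => [|P c IHP].
  have -> : peval 0 = cst 0 by apply/funext => q; rewrite /peval /bieval !horner0.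
  exact: cvg_cst.
have -> : peval (P * 'X + c%:P) = fun q => peval P q * q.2 + c.[q.1].
  by apply/funext => q; exact: bieval_MXaddC.
apply: cvgD; first by apply: cvgM => //; exact: cvg_snd.
by apply: (@continuous_comp _ _ _ fst (horner c)); [exact: cvg_fst|exact: continuous_horner].
Qed.

(** Fractions are kept as formal pairs, since the argument at a test needs to
    pass from an equality at p0 to an equality of polynomials. *)
Definition frac : Type := ({poly {poly R}} * {poly {poly R}})%type.

Definition feval (f : frac) p : R := peval f.1 p / peval f.2 p.

Definition ftape (phi : int -> frac) p : tape R := fun i => feval (phi i) p.

Variables (K : set {poly {poly R}}) (p0 : R * R).
Hypothesis K1 : K 1.
Hypothesis KB : forall P Q, K P -> K Q -> K (P - Q).
Hypothesis KM : forall P Q, K P -> K Q -> K (P * Q).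
Hypothesis p0_generic : forall P, K P -> peval P p0 = 0 -> P = 0.

(** By genericity, a nonzero denominator in K does not vanish at p0. *)
Definition regular (f : frac) : Prop := [/\ K f.1, K f.2 & f.2 <> 0].

Lemma peval_p0_neq0 P : K P -> P <> 0 -> peval P p0 != 0.
Proof. by move=> KP P0; apply/eqP => /(p0_generic KP). Qed.

Lemma near_peval_neq0 P : K P -> P <> 0 -> \forall p \near p0, peval P p != 0.
Proof.
move=> KP P0; exact: (cvgr_neq0 (peval P p0) (@peval_continuous P p0) (peval_p0_neq0 KP P0)).
Qed.

Lemma feval_continuous f : regular f -> {for p0, continuous (feval f)}.
Proof.
move=> [K1f K2f f0]; apply: cvgM; first exact: peval_continuous.
apply: (cvgV (peval_p0_neq0 K2f f0)); exact: peval_continuous.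
Qed.

Definition fsub (f g : frac) : frac := (f.1 * g.2 - g.1 * f.2, f.2 * g.2).
Definition fmul (f g : frac) : frac := (f.1 * g.1, f.2 * g.2).
Definition fdiv (f g : frac) : frac := (f.1 * g.2, f.2 * g.1).
Definition fadd (f g : frac) : frac := fsub f (fsub (0, 1) g).

Lemma K_0 : K 0. Proof. by rewrite -(subrr 1); exact: KB. Qed.

Let mul_neq0 P Q : P <> 0 -> Q <> 0 -> P * Q <> 0.
Proof. by move=> /eqP P0 /eqP Q0; apply/eqP; rewrite mulf_neq0. Qed.

Lemma regular0 : regular (0, 1).
Proof. by split=> //=; [exact: K_0|exact/eqP/oner_neq0]. Qed.

Lemma regular_sub f g : regular f -> regular g -> regular (fsub f g) /\
  \forall p \near p0, feval (fsub f g) p = feval f p - feval g p.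
Proof.
move=> [Kf1 Kf2 f0] [Kg1 Kg2 g0]; split.
  by split=> /=; [apply: KB; exact: KM|exact: KM|exact: mul_neq0].
near=> p; rewrite /feval /= pevalB !pevalM; field.
by apply/andP; split; near: p; exact: near_peval_neq0.
Unshelve. all: by end_near. Qed.

Lemma regular_mul f g : regular f -> regular g -> regular (fmul f g) /\
  \forall p \near p0, feval (fmul f g) p = feval f p * feval g p.
Proof.
move=> [Kf1 Kf2 f0] [Kg1 Kg2 g0]; split.
  by split=> /=; [exact: KM|exact: KM|exact: mul_neq0].
near=> p; rewrite /feval /= !pevalM; field.
by apply/andP; split; near: p; exact: near_peval_neq0.
Unshelve. all: by end_near. Qed.

Lemma regular_add f g : regular f -> regular g -> regular (fadd f g) /\
  \forall p \near p0, feval (fadd f g) p = feval f p + feval g p.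
Proof.
move=> rf rg; have [rNg Ng] := regular_sub regular0 rg.
have [rfg fg] := regular_sub rf rNg; split=> //; near=> p.
have -> : feval (fadd f g) p = feval f p - feval (fsub (0, 1) g) p by near: p.
have -> : feval (fsub (0, 1) g) p = feval (0, 1) p - feval g p by near: p.
by rewrite /feval /= /peval /bieval !horner0 mul0r sub0r opprK.
Unshelve. all: by end_near. Qed.

Lemma feval_p0_eq0 f : regular f -> feval f p0 = 0 -> f.1 = 0.
Proof.
move=> [K1f K2f f0] /eqP; rewrite mulf_eq0 invr_eq0.
by rewrite (negPf (peval_p0_neq0 K2f f0)) orbF => /eqP /(p0_generic K1f).
Qed.

Lemma regular_div f g : regular f -> regular g -> feval g p0 != 0 ->
  regular (fdiv f g) /\
  \forall p \near p0, feval g p != 0 /\ feval (fdiv f g) p = feval f p / feval g p.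
Proof.
move=> [Kf1 Kf2 f0] rg gp0; have [Kg1 Kg2 g0] := rg.
have g1 : g.1 <> 0.
  by move=> g1; move: gp0; rewrite /feval g1 /peval /bieval !horner0 mul0r eqxx.
split; first by split=> /=; [exact: KM|exact: KM|exact: mul_neq0].
near=> p.
have e1 : peval f.2 p != 0 by near: p; exact: near_peval_neq0.
have e2 : peval g.2 p != 0 by near: p; exact: near_peval_neq0.
have e3 : peval g.1 p != 0 by near: p; exact: near_peval_neq0.
split; first by rewrite mulf_neq0 // invr_neq0.
rewrite /feval /= !pevalM; field.
by rewrite e1 e2 e3.
Unshelve. all: by end_near. Qed.

(** If the two values differ at p0, then the sign of the difference is constant
    near p0 by continuity.  If they agree, then the numerator of the difference
    vanishes at p0, hence is the zero polynomial by genericity. *)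
Lemma regular_le f g : regular f -> regular g ->
  \forall p \near p0, (feval f p <= feval g p) = (feval f p0 <= feval g p0).
Proof.
move=> rf rg; have [rs sE] := regular_sub rf rg.
have sE0 := nbhs_singleton sE.
have cs := feval_continuous rs.
case: (ltgtP (feval f p0) (feval g p0)) => fg0.
- near=> p; rewrite -subr_le0.
  have <- : feval (fsub f g) p = feval f p - feval g p by near: p.
  apply: ltW; near: p; apply: (cvgr_lt (feval (fsub f g) p0)) => //.
  by rewrite sE0 subr_lt0.
- near=> p; apply/negbTE; rewrite -ltNge -subr_gt0.
  have <- : feval (fsub f g) p = feval f p - feval g p by near: p.
  near: p; apply: (cvgr_gt (feval (fsub f g) p0)) => //.
  by rewrite sE0 subr_gt0.
- have s0 : (fsub f g).1 = 0 by apply: feval_p0_eq0 => //; rewrite sE0 fg0 subrr.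
  near=> p; rewrite -subr_le0.
  have <- : feval (fsub f g) p = feval f p - feval g p by near: p.
  by rewrite /feval s0 /peval /bieval !horner0 mul0r lexx.
Unshelve. all: by end_near. Qed.

Definition fset_cell (phi : int -> frac) i f : int -> frac :=
  fun j => if j == i then f else phi j.

Lemma ftape_set_cell phi i f p :
  ftape (fset_cell phi i f) p = set_cell (ftape phi p) i (feval f p).
Proof. by apply/funext => j; rewrite /ftape /fset_cell /set_cell; case: eqP. Qed.

Lemma regular_set_cell phi i f : (forall j, regular (phi j)) -> regular f ->
  forall j, regular (fset_cell phi i f j).
Proof. by move=> rphi rf j; rewrite /fset_cell; case: eqP. Qed.

(** The step taken at p0 is taken at all points near p0.  The neighbourhood
    depends on the finitely many cells involved in the step only, although the
    tape is infinite. *)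
Lemma near_bss_step M l phi c :
  (forall n i a, nth BHalt M n = BConst i a -> K a%:P%:P) ->
  (forall i, regular (phi i)) -> bss_step M (l, ftape phi p0) = Some c ->
  exists psi, (forall i, regular (psi i)) /\
    \forall p \near p0, bss_step M (l, ftape phi p) = Some (c.1, ftape psi p).
Proof.
move=> KMc rphi /=; case E : (nth BHalt M l) => [i a|i j k|i j k|i j k|i j k|||i j l'|] //.
- case=> <- /=; exists (fset_cell phi i (a%:P%:P, 1)); split.
    apply: regular_set_cell => //; split=> //=; [exact: KMc E|exact/eqP/oner_neq0].
  near=> p; rewrite ftape_set_cell; congr (Some (_, set_cell _ _ _)).
  by rewrite /feval /= -[1]/(1%:P%:P) !pevalC divr1.
- case=> <- /=; have [rf fE] := regular_add (rphi j) (rphi k).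
  exists (fset_cell phi i (fadd (phi j) (phi k))); split.
    exact: regular_set_cell.
  by near=> p; rewrite ftape_set_cell; congr (Some (_, set_cell _ _ _)); near: p;
    apply: filterS fE => p ->.
- case=> <- /=; have [rf fE] := regular_sub (rphi j) (rphi k).
  exists (fset_cell phi i (fsub (phi j) (phi k))); split.
    exact: regular_set_cell.
  by near=> p; rewrite ftape_set_cell; congr (Some (_, set_cell _ _ _)); near: p;
    apply: filterS fE => p ->.
- case=> <- /=; have [rf fE] := regular_mul (rphi j) (rphi k).
  exists (fset_cell phi i (fmul (phi j) (phi k))); split.
    exact: regular_set_cell.
  by near=> p; rewrite ftape_set_cell; congr (Some (_, set_cell _ _ _)); near: p;
    apply: filterS fE => p ->.
- case: eqP => // /eqP k0; case=> <- /=.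
  have [rf fE] := regular_div (rphi j) (rphi k) k0.
  exists (fset_cell phi i (fdiv (phi j) (phi k))); split.
    exact: regular_set_cell.
  by apply: filterS fE => p [pk fE]; rewrite (negPf pk) ftape_set_cell fE.
- by case=> <-; exists (fun i => phi (i + 1)); split => //; near=> p.
- by case=> <-; exists (fun i => phi (i - 1)); split => //; near=> p.
- case=> <-; exists phi; split=> //.
  by apply: filterS (regular_le (rphi i) (rphi j)) => p; rewrite /ftape => ->.
Unshelve. all: by end_near. Qed.

Lemma bss_runS M (x : seq R) t :
  bss_run M x t.+1 = obind (bss_step M) (bss_run M x t).
Proof. by []. Qed.

Lemma near_bss_run M t c :
  (forall n i a, nth BHalt M n = BConst i a -> K a%:P%:P) ->
  K ('X)%:P -> K 'X ->
  bss_run M [:: p0.1; p0.2] t = Some c ->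
  exists phi, (forall i, regular (phi i)) /\
    \forall p \near p0, bss_run M [:: p.1; p.2] t = Some (c.1, ftape phi p).
Proof.
move=> KMc KX KY; elim: t c => [|t IHt] c.
  case=> <-.
  (* Cells 0 and 1 contain the input, cells -1 and -2 its length in unary. *)
  pose phi (i : int) : frac := match i with
    | Posz 0 => (('X)%:P, 1) | Posz 1 => ('X, 1) | Negz 0 | Negz 1 => (1, 1)
    | _ => (0, 1) end.
  exists phi; split.
    have oneN0 : (1 : {poly {poly R}}) <> 0 by apply/eqP; exact: oner_neq0.
    by move=> [[|[|n]]|[|[|n]]]; split => //=; exact: K_0.
  near=> p; congr (Some (_, _)); apply/funext => i.
  by case: i => [[|[|n]]|[|[|n]]] /=;
    rewrite /ftape /feval /peval /bieval /= ?nth_nil ?hornerE ?divr1 ?invr1.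
rewrite bss_runS; case E : (bss_run M _ t) => [c0|] //= c0c.
have [phi [rphi phiE]] := IHt _ E.
have := nbhs_singleton phiE; rewrite E => -[c0E]; rewrite c0E in c0c.
have [psi [rpsi psiE]] := near_bss_step KMc rphi c0c.
exists psi; split=> //; near=> p.
have -> : bss_run M [:: p.1; p.2] t = Some (c0.1, ftape phi p) by near: p.
by rewrite /=; near: p.
Unshelve. all: by end_near. Qed.

End Machine.

(** * The boundary of the set and the contradiction *)

Section Undecidable.
Variable R : realType.
Implicit Types (M : bss_machine R) (p : R * R).

(** A halted configuration has no successor, so a run passes through at most
    one of them. *)
Lemma bss_halted_unique M x t t' c c' :
  bss_run M x t = Some c -> bss_halted M c ->
  bss_run M x t' = Some c' -> bss_halted M c' -> c = c'.
Proof.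
have stop d n k : bss_run M x n = Some d -> bss_halted M d ->
    bss_run M x (k.+1 + n) = None.
  move=> rd [_ dh]; rewrite /bss_run iterD -/(bss_run M x n) rd iterSr /=.
  have -> : bss_step M d = None by case: d {rd} dh => l s /= ->.
  by elim: k => //= k ->.
move=> rc hc rc' hc'; have [tt'|t't|tt'] := ltngtP t t'.
- by move: rc'; rewrite -(subnK tt') addnS -addSn (stop _ _ _ rc hc).
- by move: rc; rewrite -(subnK t't) addnS -addSn (stop _ _ _ rc' hc').
- by move: rc; rewrite tt' rc' => -[].
Qed.

Definition exp_real_parts : set (R * R) :=
  real_parts (zero_set (fun z : R[i] * R[i] => 1 - cexp z.1 - cexp z.2)).

(** Take z1 = ln t + i pi and z2 = ln (1 + t), so that 1 - (- t) - (1 + t) = 0. *)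
Lemma boundary_mem (t : R) : 0 < t -> exp_real_parts (ln t, ln (1 + t)).
Proof.
move=> t0; exists (Complex (ln t) pi, Complex (ln (1 + t)) 0) => //.
rewrite /zero_set /= /cexp /= !lnK ?posrE ?addr_gt0 // cospi sinpi cos0 sin0.
by apply/eqP; rewrite eq_complex /=; apply/andP; split; apply/eqP; ring.
Qed.

(** This is |e^z2| = |1 - e^z1| <= 1 + |e^z1|, with the moduli squared. *)
Lemma real_parts_le p : exp_real_parts p -> expR p.2 <= 1 + expR p.1.
Proof.
move=> [[[a b] [c d]]] /= /eqP; rewrite eq_complex /= => /andP[/eqP re /eqP im] <- /=.
have h1 : expR c * cos d = 1 - expR a * cos b by lra.
have h2 : expR c * sin d = - (expR a * sin b) by lra.
have ea := expR_gt0 a; have ec := expR_gt0 c.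
have cd := cos2Dsin2 d; have cb := cos2Dsin2 b.
have cb1 := cos_geN1 b.
rewrite -(ler_pXn2r (n := 2)) ?nnegrE ?addr_ge0 ?expR_ge0 //.
have -> : expR c ^+ 2 = (expR c * cos d) ^+ 2 + (expR c * sin d) ^+ 2.
  by rewrite !exprMn -mulrDr cd mulr1.
rewrite h1 h2.
have -> : (1 - expR a * cos b) ^+ 2 + (- (expR a * sin b)) ^+ 2 =
  1 - 2 * (expR a * cos b) + expR a ^+ 2 * (cos b ^+ 2 + sin b ^+ 2) by ring.
rewrite cb; nra.
Qed.

End Undecidable.
Arguments exp_real_parts : clear implicits.

Theorem theorem1p1 (R : realType) :
  ~ bss_decidable (fun r : R * R => [:: r.1; r.2])
      (real_parts (zero_set (fun z : R[i] * R[i] => 1 - cexp z.1 - cexp z.2))).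
Proof.
move=> [M]; rewrite -/(exp_real_parts R) => MP.
(* Indexing the constants by the lines of the program shows that there are
   countably many of them. *)
pose consts n : {poly {poly R}} :=
  if nth BHalt M n is BConst _ a then a%:P%:P else 1.
have [|K [cK SK K1 KB KM]] :=
  @countable_subring _ ([set 'X; ('X)%:P] `|` range consts).
  apply: countableU; first exact: finite_set_countable.
  exact: sub_countable (card_image_le _ _) _.
have [t t0 tgen] := exists_generic cK.
pose p0 : R * R := (ln t, ln (1 + t)).
have [T [c [rT hT oT]]] := MP p0.
have KM_const n i a : nth BHalt M n = BConst i a -> K a%:P%:P.
  by move=> E; apply: SK; right; exists n => //; rewrite /consts E.
have KX : K ('X)%:P by apply: SK; left; right.
have KY : K 'X by apply: SK; left; left.
have [phi [rphi phiE]] :=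
  near_bss_run (p0 := p0) K1 KB KM tgen KM_const KX KY rT.
have outE : \forall p \near p0, \1_(exp_real_parts R) p = feval (phi 0) p :> R.
  apply: filterS phiE => p rp.
  have [T' [c' [rT' hT' <-]]] := MP p.
  by rewrite (bss_halted_unique rT' hT' rp hT).
have phi1 : feval (phi 0) p0 = 1.
  by rewrite -(nbhs_singleton outE) indicE mem_set //; exact: boundary_mem.
have phi_cont : feval (phi 0) p @[p --> p0] --> (1 : R).
  by rewrite -[X in _ --> X]phi1; exact: (feval_continuous (p0 := p0) tgen (rphi 0)).
have : \forall p \near p0, exp_real_parts R p.
  near=> p; have : 0 < feval (phi 0) p.
    by near: p; exact: (cvgr_gt 1 phi_cont).
  have <- : \1_(exp_real_parts R) p = feval (phi 0) p :> R by near: p.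
  by rewrite indicE ltr0n lt0b => /set_mem.
move=> /nbhs_ballP[e /= e0 be].
(* Moving up from p0 inside the ball leaves the set. *)
have /real_parts_le /= : exp_real_parts R (ln t, ln (1 + t) + e / 2).
  apply: be; split=> /=; first exact: ballxx.
  rewrite /ball /= opprD addNKr normrN gtr0_norm ?divr_gt0 //.
  by rewrite ltr_pdivrMr // mulr_natr mulr2n ltrDl.
rewrite lnK ?posrE // expRD lnK ?posrE ?addr_gt0 //.
apply/negP; rewrite -ltNge ltr_pMr ?addr_gt0 // -expR0 ltr_expR divr_gt0 //.
Unshelve. all: by end_near. Qed.
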